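(* Let $A\in\mathbb{C}^{n\times n}$ be a Hermitian matrix and let $Q=[Q_1\ \ Q_2]\in\mathbb{C}^{n\times n}$ be a unitary matrix with $Q_1\in\mathbb{C}^{n\times k}$, $1<k<n$. Assume that for some real numbers $a\leq b$ and $d>0$ the spectrum of $A_1=Q_1^HAQ_1$ lies in $(-\infty,a-d]\cup[b+d,\infty)$ and the spectrum of $A_2=Q_2^HAQ_2$ lies in $[a,b]$. Let $R=AQ_1-Q_1A_1$ and suppose that $\|R\|<\sqrt{2}\,d$. Then $n$ orthonormal eigenvectors of $A$ may be numbered in such an order that the corresponding unitary eigenvector matrix $X=[X_1\ \ X_2]$ with $X_1\in\mathbb{C}^{n\times k}$ (the columns of $X$ being these eigenvectors) reduces $A$ to the diagonal form $X^HAX=\mathrm{diag}(\Lambda_1,\Lambda_2)$, where $\Lambda_1\in\mathbb{C}^{k\times k}$ has its spectrum in $(-\infty,a-d]\cup[b+d,\infty)$ and $\Lambda_2$ has all its eigenvalues in $[a-\delta_R,\,b+\delta_R]$, with $$\delta_R=\|R\|\tan\left(\tfrac{1}{2}\arctan\frac{2\|R\|}{d}\right)<d.$$ Moreover, $$\tan\angle(\mathfrak{Q}_1,\mathfrak{X}_1)\leq\frac{\|R\|}{d},$$ where $\mathfrak{Q}_1$ and $\mathfrak{X}_1$ are the subspaces of $\mathbb{C}^n$ spanned by the columns of $Q_1$ and $X_1$, respectively.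
   Context: For a matrix $S$, $S^H$ denotes the conjugate transpose and $\|S\|$ denotes the spectral norm, i.e. the maximal singular value of $S$. For subspaces $\mathfrak{A},\mathfrak{L}$ of $\mathbb{C}^n$ (here of equal dimension), $\angle(\mathfrak{A},\mathfrak{L})\in[0,\pi/2]$ denotes the largest principal (canonical) angle between $\mathfrak{A}$ and $\mathfrak{L}$; the bound on its tangent includes the assertion that the angle is less than $\pi/2$. *)

(* Defs.v *)
From HB Require Import structures.
From mathcomp Require Import all_boot all_order all_fingroup all_algebra.
From mathcomp Require Import complex.
From mathcomp Require Import boolp classical_sets reals.
From mathcomp Require Import trigo.
Set Implicit Arguments.
Unset Strict Implicit.
Unset Printing Implicit Defensive.
Import Order.TTheory GRing.Theory Num.Theory.
Local Open Scope classical_set_scope.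
Local Open Scope ring_scope.
Local Open Scope sesquilinear_scope.
Local Open Scope complex_scope.

Definition spectrum (R : realType) (n : nat) (M : 'M[R[i]]_n) : set R[i] :=
  [set z | eigenvalue M z].

Definition real_set (R : realType) (I : set R) : set R[i] := [set x%:C | x in I].

(* Nonnegative square roots of the eigenvalues of S^H S, as a set (without
   multiplicities). When m < n this set also contains the n - m trailing zeros,
   which affects neither the largest element nor the square case. *)
Definition singular_values (R : realType) (m n : nat) (S : 'M[R[i]]_(m, n)) :
    set R :=
  [set s | 0 <= s /\ eigenvalue (S ^t* *m S) (s ^+ 2)%:C].

(* The set of singular values is finite, and nonempty as soon as n > 0, so this
   supremum is its maximum; it is 0 when n = 0. *)
Definition spectral_norm (R : realType) (m n : nat) (S : 'M[R[i]]_(m, n)) : R :=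
  sup (singular_values S).

Definition colspan (R : realType) (n p : nat) (P : 'M[R[i]]_(n, p)) :
    {vspace 'cV[R[i]]_n} :=
  <<[seq col j P | j : 'I_p]>>%VS.

Definition orthonormal_basis (R : realType) (n p : nat) (P : 'M[R[i]]_(n, p))
    (U : {vspace 'cV[R[i]]_n}) : Prop :=
  P ^t* *m P = 1%:M /\ colspan P = U.

(* The cosines of the principal (canonical) angles between two subspaces of
   equal dimension p are the singular values of P^H W, where the columns of P
   and W are orthonormal bases of the subspaces. Changing the bases multiplies
   P^H W by unitary matrices on both sides, so its singular values do not
   depend on them. The set is empty when the dimensions differ. *)
Definition principal_angles (R : realType) (n : nat)
    (U V : {vspace 'cV[R[i]]_n}) : set R :=
  [set theta | exists p (P W : 'M[R[i]]_(n, p)),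
     [/\ orthonormal_basis P U, orthonormal_basis W V &
         exists2 s, singular_values (P ^t* *m W) s & theta = acos s]].

(* A maximum when U and V have the same nonzero dimension. *)
Definition largest_angle (R : realType) (n : nat)
    (U V : {vspace 'cV[R[i]]_n}) : R :=
  sup (principal_angles U V).

Definition orthonormal_eigenvectors (R : realType) (n : nat)
    (A X : 'M[R[i]]_n) : Prop :=
  X \is unitarymx /\
  forall j, exists lambda : R[i], A *m col j X = lambda *: col j X.

(* Main.v *)
(* After subtracting the midpoint of [a, b] from A, put c = (b - a) / 2. In the
   basis Q the matrix is L = [[A1, B*], [B, A2]] with |A1 x| >= (c + d) |x|,
   |A2 y| <= c |y|, |B| = r, and e = delta_R is the root of e^2 + d e = r^2.

   Counting. On the vectors whose component along Q1 lies in the nonpositive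
   spectral subspace of A1 the form of L is at most c + e, because
   (e + d) e = r^2, so at most as many eigenvalues of L exceed c + e as A1 has
   positive eigenvalues; the same holds for - L. On the range of Q1 one has
   |L v| >= (c + d) |v|. Hence exactly k eigenvalues of L satisfy
   |lambda| >= c + d, and the other m satisfy |lambda| <= c + e.

   Angle. Let q be the tangent of the largest angle between Q2 and the inner
   spectral subspace, and x, y unit vectors such that u1 = (q x, y) lies in that
   subspace and u2 = (x, - q y) is orthogonal to it. If q <= 1, the relation
   <L u1, L u2> = 0 and Cauchy-Schwarz give q d <= r. If q > 1, the same relation
   turns |B* y|^2 into
   q^2 |A1 x|^2 - 2 <z, A2 y> + (2 |z|^2 - (q^2 - 1) |z'|^2) / (1 + q^2)
   with L u1 = (z', z). Maximality of q gives |z'| <= q |z|, and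
   |L u1| <= (c + e) |u1|; these force q d <= r when q^2 <= 2 and contradict
   r < sqrt 2 d when q^2 > 2. *)

Require Import Defs.
From HB Require Import structures.
From mathcomp Require Import all_boot all_order all_fingroup all_algebra.
From mathcomp Require Import complex.
From mathcomp Require Import boolp classical_sets reals.
From mathcomp Require Import trigo.
From mathcomp Require Import ring lra zify.
Set Implicit Arguments.
Unset Strict Implicit.
Unset Printing Implicit Defensive.
Import Order.TTheory GRing.Theory Num.Theory.
Local Open Scope classical_set_scope.
Local Open Scope ring_scope.
Local Open Scope sesquilinear_scope.
Local Open Scope complex_scope.

(** * Scalar inequalities for the tangent and the gap *)

(** Here [X], [G], [H], [E] stand for |A1 x|, |B x|, |B^H y|, |A2 y|, and [S] for the sum of the
    cross terms. If r < k d, then (X + k H)(k X - H) grows with X and decreases with H, so it may be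
    evaluated at X = c + d and H = r; the inequality obtained there contradicts r < k d. *)
Lemma tangent_le1_bound (R : realFieldType) (c d r k X H G E S : R) :
  0 <= c -> 0 < d -> 0 <= r -> 0 < k -> k <= 1 ->
  c + d <= X -> 0 <= H -> H <= r -> 0 <= G -> G <= r -> 0 <= E -> E <= c ->
  k * (X ^+ 2 + G ^+ 2 - H ^+ 2 - E ^+ 2) + (1 - k ^+ 2) * S = 0 ->
  - (H * X + E * G) <= S -> k * d <= r.
Proof.
move=> c0 d0 r0 k0 k1 hX H0 Hr G0 Gr E0 Ec e1 hS.
have s0 : 0 <= 1 - k ^+ 2 by nra.
rewrite leNgt; apply/negP => rk.
have X0 : 0 < X by lra.
have i1 : k * (X ^+ 2 + G ^+ 2 - H ^+ 2 - E ^+ 2) <= (1 - k ^+ 2) * (H * X + E * G).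
  by have := ler_wpM2l s0 hS; lra.
have iE : E * G <= c * r by apply: ler_pM.
have iE2 : E ^+ 2 <= c ^+ 2 by rewrite ler_pXn2r.
have iG2 : 0 <= G ^+ 2 by apply: sqr_ge0.
have i2 : (X + k * H) * (k * X - H) <= k * c ^+ 2 + (1 - k ^+ 2) * (c * r).
  have h1 := ler_wpM2l s0 iE; have h2 := ler_wpM2l (ltW k0) iE2.
  have h3 := mulr_ge0 (ltW k0) iG2; nra.
have i3 : ((c + d) + k * H) * (k * (c + d) - H) <= (X + k * H) * (k * X - H).
  have h0: 0 <= k * (X + (c + d)) - (1 - k ^+ 2) * H by nra.
  have hx : 0 <= X - (c + d) by lra.
  have := mulr_ge0 hx h0; nra.
have i4 : ((c + d) + k * r) * (k * (c + d) - r) <= ((c + d) + k * H) * (k * (c + d) - H).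
  have hx : 0 <= r - H by lra.
  have h0 : 0 <= (1 - k ^+ 2) * (c + d) + k * (r + H) by nra.
  have := mulr_ge0 hx h0; nra.
have i5 : (1 - k ^+ 2) * (2 * c + d) * r + k * r ^+ 2 <
    k * d * ((1 - k ^+ 2) * (2 * c + d) + k * (k * d)).
  have h0 : 0 <= (1 - k ^+ 2) * (2 * c + d) by apply: mulr_ge0 => //; lra.
  have h1 := ler_wpM2l h0 (ltW rk).
  have h2 : r ^+ 2 < (k * d) ^+ 2 by rewrite ltr_pXn2r // nnegrE mulr_ge0 // ltW.
  have h3 : k * r ^+ 2 < k * (k * d) ^+ 2 by rewrite ltr_pM2l.
  nra.
have i6 : 0 <= k * d * (2 * c * k ^+ 2).
  by rewrite !mulr_ge0 ?sqr_ge0 // ltW.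
nra.
Qed.

(** [X2], [G2], [H2], [E2] are the squares of those lengths, [P] and [T] the cross terms, [x2] and
    [y2] the squared lengths of the two blocks of L u1. Eliminating the cross term [P] expresses
    [H2], which is at most r^2, by quantities bounded below in terms of t. *)
Lemma tangent_ge1_bound (R : realFieldType) (c d e r k X2 H2 G2 E2 P T y2 t x2 : R) :
  0 <= c -> 0 < d -> 0 <= r -> 1 <= k -> 0 <= e -> e < d -> e ^+ 2 + d * e = r ^+ 2 ->
  (c + d) ^+ 2 <= X2 -> H2 <= r ^+ 2 ->
  k * (X2 + G2 - H2 - E2) + (1 - k ^+ 2) * (P + T) = 0 ->
  y2 = k ^+ 2 * G2 + 2 * k * T + E2 ->
  x2 = k ^+ 2 * X2 + 2 * k * P + H2 ->
  0 <= t -> t ^+ 2 = y2 ->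
  k * T + E2 <= c * t ->
  x2 <= k ^+ 2 * y2 -> x2 + y2 <= (1 + k ^+ 2) * (c + e) ^+ 2 ->
  k * d <= r.
Proof.
move=> c0 d0 r0 k1 e0 ed er hX hH e1 hy hx t0 ht hT hxy hs.
have k0 : 0 < k by lra.
have q0 : 0 < 1 + k ^+ 2 by nra.
(* The orthogonality relation times 2 k^2 removes [P], which enters through [x2]; the common factor
   k is cancelled afterwards. *)
have e2 : k * ((1 + k ^+ 2) * H2) =
    k * ((1 + k ^+ 2) * (k ^+ 2 * X2 - 2 * (k * T + E2)) + 2 * y2 - (k ^+ 2 - 1) * x2).
  rewrite hy hx.
  have : 2 * k ^+ 2 * (k * (X2 + G2 - H2 - E2) + (1 - k ^+ 2) * (P + T)) = 0 by rewrite e1 mulr0.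
  lra.
have {}e2 := mulfI (lt0r_neq0 k0) e2.
have i1 : (1 + k ^+ 2) * (k ^+ 2 * (c + d) ^+ 2 - 2 * c * t) + 2 * t ^+ 2 - (k ^+ 2 - 1) * x2
    <= (1 + k ^+ 2) * r ^+ 2.
  have h1 := ler_wpM2l (ltW q0) hH.
  have h2 : k ^+ 2 * (c + d) ^+ 2 - 2 * c * t <= k ^+ 2 * X2 - 2 * (k * T + E2).
    have := ler_wpM2l (sqr_ge0 k) hX; lra.
  have := ler_wpM2l (ltW q0) h2; lra.
rewrite -ht in hxy hs.
have s0 : 0 <= k ^+ 2 - 1 by nra.
(* [z] is t truncated at c + e. Below the threshold the bound x2 <= k^2 y2 is used; above it, the
   bound on x2 + y2 and the monotonicity of t^2 - 2 c t for t >= c. *)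
have i2 : exists2 z, 0 <= z <= c + e &
    k ^+ 2 * (c + d) ^+ 2 - 2 * c * z - (k ^+ 2 - 2) * z ^+ 2 <= r ^+ 2.
  case: (lerP t (c + e)) => tc.
    exists t; first by rewrite t0.
    have h := ler_wpM2l s0 hxy.
    rewrite -(ler_pM2l q0); lra.
  exists (c + e); first by lra.
  have h := ler_wpM2l s0 hs.
  have h1 : 0 <= (t - (c + e)) * (t + (c + e) - 2 * c) by apply: mulr_ge0; lra.
  have h2 := mulr_ge0 (ltW q0) h1.
  rewrite -(ler_pM2l q0); lra.
case: i2 => z /andP[z0 zc] i2.
case: (lerP (k ^+ 2) 2) => k2.
  (* The left side is 2 (k^2 - 1) c z + (2 - k^2)(2 c z - z^2), where c z <= c (c + 2 d) and 2 c z -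
     z^2 <= c^2. *)
  have h1 : 2 * c * z - (2 - k ^+ 2) * z ^+ 2 <= k ^+ 2 * (2 * c * d + c ^+ 2).
    have u0 : 0 <= 2 - k ^+ 2 by lra.
    have j1 : 0 <= (k ^+ 2 - 1) * (c * (c + 2 * d) - c * z).
      by apply: mulr_ge0 => //; nra.
    have j2 : 0 <= (2 - k ^+ 2) * ((z - c) ^+ 2).
      by apply: mulr_ge0 => //; exact: sqr_ge0.
    have j3 : 0 <= (2 - k ^+ 2) * (c * d).
      by rewrite !mulr_ge0 // ltW.
    have j4 : 0 <= (k ^+ 2 - 1) * (c * (c + 2 * d - z)).
      by rewrite !mulr_ge0 //; lra.
    nra.
  have h2 : (k * d) ^+ 2 <= r ^+ 2 by nra.
  by move: h2; rewrite ler_pXn2r // nnegrE mulr_ge0 // ltW.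
(* The left side of [i2] is at least 2 (c + d)^2 - 2 c (c + e) >= 2 d^2, whereas e < d gives r^2 < 2
   d^2. *)
exfalso.
have h1 : 0 <= (k ^+ 2 - 2) * ((c + d) ^+ 2 - z ^+ 2).
  by apply: mulr_ge0; nra.
nra.
Qed.

(** Source of the constant sqrt 2: e^2 + d e increases for e >= 0 and equals 2 d^2 at e = d. *)
Lemma gap_shift_lt (R : realFieldType) (d r e : R) :
  0 < d -> 0 <= r -> 0 <= e -> e ^+ 2 + d * e = r ^+ 2 ->
  r ^+ 2 < 2 * d ^+ 2 -> e < d.
Proof. move=> *; rewrite ltNge; apply/negP; nra. Qed.


(** The right side minus the left is 2 c p^2 plus (e + d) p^2 - 2 r p q + e q^2, and the latter is a
    square divided by e + d because (e + d) e = r^2. *)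
Lemma gap_form_le (R : realFieldType) (c d e r p q : R) :
  0 <= c -> 0 < d -> 0 <= r -> 0 <= e -> e ^+ 2 + d * e = r ^+ 2 ->
  - (c + d) * p ^+ 2 + 2 * (r * p * q) + c * q ^+ 2 <= (c + e) * (p ^+ 2 + q ^+ 2).
Proof.
move=> c0 d0 r0 e0 er.
have h1 : 0 <= (e + d) * p ^+ 2 - 2 * (r * p * q) + e * q ^+ 2.
  have ed : 0 < e + d by lra.
  rewrite -(pmulr_rge0 _ ed).
  have : 0 <= ((e + d) * p - r * q) ^+ 2 by apply: sqr_ge0.
  have er2 : r ^+ 2 * q ^+ 2 = (e ^+ 2 + d * e) * q ^+ 2 by rewrite er.
  move: er2; lra.
have h2 := mulr_ge0 c0 (sqr_ge0 p); lra.
Qed.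

(** The double-angle formula gives 2 r / d = 2 T / (1 - T^2), that is r (1 - T^2) = d T; multiplying
    by r gives the quadratic equation. *)
Lemma half_angle_quadratic (R : realType) (d r : R) : 0 < d -> 0 <= r ->
  let e := r * tan (2^-1 * atan (2 * r / d)) in
  0 <= e /\ e ^+ 2 + d * e = r ^+ 2.
Proof.
move=> d0 r0; set f := 2^-1 * atan _; set T := tan f => e.
have at0 : 0 <= atan (2 * r / d).
  by rewrite -atan0 le_atan // divr_ge0 ?mulr_ge0 // ltW.
have atpi := atan_ltpi2 (2 * r / d).
have f2 : f *+ 2 = atan (2 * r / d) by rewrite /f -[LHS]mulr_natl mulrA mulfV ?mul1r ?pnatr_eq0.
have cf : 0 < cos f.
  apply: cos_gt0_pihalf; move: f2 at0 atpi; rewrite mulr2n.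
  move: (atan _) (pi / 2); clear; intros; lra.
have T0 : 0 <= T.
  rewrite /T /tan divr_ge0 ?(ltW cf) // sin_ge0_pi //; move: f2 at0 atpi (pi_gt0 R).
  rewrite mulr2n; move: (atan _) (pi); clear; intros; lra.
split; first exact: mulr_ge0.
have := tan_mulr2n (lt0r_neq0 cf); rewrite f2 atanK -/T => h.
(* If 1 - T^2 vanished, the convention 0^-1 = 0 would force r = 0, hence T = 0. *)
have T1 : 1 - T ^+ 2 != 0.
  apply/negP => /eqP T1; move: h; rewrite T1 invr0 mulr0 => /eqP.
  rewrite mulf_eq0 invr_eq0 (gt_eqF d0) orbF mulf_eq0 pnatr_eq0 /= => /eqP r00.
  move: T1; rewrite /T /f r00 mulr0 mul0r atan0 mulr0 tan0 expr0n subr0 => /eqP.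
  by rewrite oner_eq0.
have {}h : r * (1 - T ^+ 2) = d * T.
  have -> : r = 2 * r / d * (d / 2) by field; rewrite lt0r_neq0.
  by rewrite h; field; rewrite T1.
rewrite /e; move: (congr1 ( *%R r) h); clear; lra.
Qed.

(** * Real Euclidean structure on complex vectors *)

(** Taking the real part gives a symmetric bilinear form over the reals with the same squared
    lengths, so that all estimates live in [R]. *)
Definition rdot (R : realType) n (u v : 'cV[R[i]]_n) : R :=
  complex.Re ((u ^t* *m v) 0 0).

Definition nsq (R : realType) n (u : 'cV[R[i]]_n) : R := rdot u u.

Lemma rdotE (R : realType) n (u v : 'cV[R[i]]_n) :
  rdot u v = \sum_i (complex.Re (u i 0) * complex.Re (v i 0) +
                     complex.Im (u i 0) * complex.Im (v i 0)).
Proof.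
rewrite /rdot !mxE (big_morph (@complex.Re R) (id1 := 0) (op1 := +%R)) //;
  last by move=> [? ?] [? ?].
apply: eq_bigr => i _; rewrite !mxE.
by case: (u i 0) (v i 0) => [a b] [c e] /=; rewrite mulNr opprK.
Qed.

Lemma rdotC (R : realType) n (u v : 'cV[R[i]]_n) : rdot u v = rdot v u.
Proof. by rewrite !rdotE; apply: eq_bigr => i _; rewrite mulrC [X in _ + X]mulrC. Qed.

Lemma rdotDr (R : realType) n (u v w : 'cV[R[i]]_n) :
  rdot u (v + w) = rdot u v + rdot u w.
Proof. by rewrite /rdot mulmxDr mxE raddfD. Qed.

Lemma rdotDl (R : realType) n (u v w : 'cV[R[i]]_n) :
  rdot (v + w) u = rdot v u + rdot w u.
Proof. by rewrite !(rdotC _ u) rdotDr. Qed.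

Lemma rdotZr (R : realType) n (a : R) (u v : 'cV[R[i]]_n) :
  rdot u (a%:C *: v) = a * rdot u v.
Proof.
by rewrite /rdot -scalemxAr mxE; case: (_ 0 0) => x y /=; rewrite mul0r subr0.
Qed.

Lemma rdotZl (R : realType) n (a : R) (u v : 'cV[R[i]]_n) :
  rdot (a%:C *: u) v = a * rdot u v.
Proof. by rewrite rdotC rdotZr rdotC. Qed.

Lemma rdotNr (R : realType) n (u v : 'cV[R[i]]_n) : rdot u (- v) = - rdot u v.
Proof. by rewrite /rdot mulmxN mxE raddfN. Qed.

Lemma rdotNl (R : realType) n (u v : 'cV[R[i]]_n) : rdot (- u) v = - rdot u v.
Proof. by rewrite rdotC rdotNr rdotC. Qed.

Definition rdot_lin := (rdotDr, rdotDl, rdotNr, rdotNl, rdotZr, rdotZl).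

Lemma adjmxM (R : realType) m n p (A : 'M[R[i]]_(m, n)) (B : 'M[R[i]]_(n, p)) :
  (A *m B) ^t* = B ^t* *m A ^t*.
Proof. by rewrite trmx_mul map_mxM. Qed.

Lemma rdot_mulmxr (R : realType) m n (M : 'M[R[i]]_(m, n)) u v :
  rdot u (M *m v) = rdot (M ^t* *m u) v.
Proof. by rewrite /rdot adjmxM trmxCK mulmxA. Qed.

Lemma rdot_mulmxl (R : realType) m n (M : 'M[R[i]]_(m, n)) u v :
  rdot (M *m v) u = rdot v (M ^t* *m u).
Proof. by rewrite rdotC rdot_mulmxr rdotC. Qed.

Lemma nsq_ge0 (R : realType) n (u : 'cV[R[i]]_n) : 0 <= nsq u.
Proof. by rewrite /nsq rdotE sumr_ge0 // => i _; rewrite -!expr2 addr_ge0 ?sqr_ge0. Qed.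

Lemma nsq_eq0 (R : realType) n (u : 'cV[R[i]]_n) : (nsq u == 0) = (u == 0).
Proof.
apply/idP/eqP => [|->]; last by rewrite /nsq /rdot mulmx0 mxE.
rewrite /nsq rdotE psumr_eq0 => [/allP h|i _]; last by rewrite -!expr2 addr_ge0 ?sqr_ge0.
apply/matrixP => i j; rewrite ord1 mxE.
have := h i (mem_index_enum _); rewrite -!expr2 paddr_eq0 ?sqr_ge0 // !sqrf_eq0.
by case: (u i 0) => a b /= /andP[/eqP-> /eqP->].
Qed.

Lemma nsqZ (R : realType) n (a : R) (u : 'cV[R[i]]_n) :
  nsq (a%:C *: u) = a ^+ 2 * nsq u.
Proof. by rewrite /nsq rdotZr rdotZl mulrA expr2. Qed.

Lemma nsqD (R : realType) n (u v : 'cV[R[i]]_n) :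
  nsq (u + v) = nsq u + 2 * rdot u v + nsq v.
Proof. by rewrite /nsq !rdot_lin (rdotC v u); ring. Qed.

Lemma rdot_CS (R : realType) n (u v : 'cV[R[i]]_n) :
  rdot u v ^+ 2 <= nsq u * nsq v.
Proof.
have [/eqP|] := eqVneq (nsq v) 0.
  by rewrite nsq_eq0 => /eqP->; rewrite /nsq /rdot !mulmx0 !mxE /= expr0n mulr0.
rewrite neq_lt ltNge nsq_ge0 /= => v0.
have := nsq_ge0 ((nsq v)%:C *: u + (- rdot u v)%:C *: v).
rewrite nsqD !nsqZ rdotZr rdotZl => h.
rewrite -subr_ge0 -(pmulr_rge0 _ v0); apply: le_trans h _.
by rewrite le_eqVlt; apply/orP; left; apply/eqP; ring.
Qed.

Lemma rdot_le (R : realType) n (u v : 'cV[R[i]]_n) :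
  rdot u v <= Num.sqrt (nsq u) * Num.sqrt (nsq v).
Proof.
have h : 0 <= Num.sqrt (nsq u) * Num.sqrt (nsq v) by rewrite mulr_ge0 ?sqrtr_ge0.
have [/le_trans|/ltW h0] := lerP (rdot u v) 0; first by apply.
rewrite -(@ler_pXn2r _ 2) // exprMn !sqr_sqrtr ?nsq_ge0 //; exact: rdot_CS.
Qed.

Lemma nsq_isometry (R : realType) m n (U : 'M[R[i]]_(m, n)) x :
  U ^t* *m U = 1%:M -> nsq (U *m x) = nsq x.
Proof. by move=> h; rewrite /nsq rdot_mulmxr mulmxA h mul1mx. Qed.

Lemma unitarymx_adj_mul (R : realType) n (U : 'M[R[i]]_n) :
  U \is unitarymx -> U ^t* *m U = 1%:M.
Proof. by rewrite -trmxC_unitary => /unitarymxP; rewrite trmxCK. Qed.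

(** * Hermitian matrices and real diagonal forms *)

Lemma hermsymmx_adj (R : realType) n (H : 'M[R[i]]_n) :
  reflect (H ^t* = H) (H \is hermsymmx).
Proof.
rewrite is_hermitianmxE expr0 scale1r.
by apply: (iffP eqP) => // <-.
Qed.

Definition rdiag (R : realType) n (d : 'I_n -> R) : 'M[R[i]]_n :=
  diag_mx (\row_j (d j)%:C).

Lemma rdiag_mulE (R : realType) n (d : 'I_n -> R) (u : 'cV[R[i]]_n) i :
  (rdiag d *m u) i 0 = (d i)%:C * u i 0.
Proof. by rewrite mul_diag_mx !mxE. Qed.

Lemma rdot_rdiag (R : realType) n (d : 'I_n -> R) (u : 'cV[R[i]]_n) :
  rdot u (rdiag d *m u) =
  \sum_i d i * ((complex.Re (u i 0)) ^+ 2 + (complex.Im (u i 0)) ^+ 2).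
Proof.
rewrite rdotE; apply: eq_bigr => i _; rewrite rdiag_mulE.
by case: (u i 0) => a b /=; ring.
Qed.

Lemma nsqE (R : realType) n (u : 'cV[R[i]]_n) :
  nsq u = \sum_i ((complex.Re (u i 0)) ^+ 2 + (complex.Im (u i 0)) ^+ 2).
Proof. by rewrite /nsq rdotE. Qed.

Lemma rdiagM (R : realType) n (d e : 'I_n -> R) :
  rdiag d *m rdiag e = rdiag (fun i => d i * e i).
Proof.
rewrite /rdiag mulmx_diag; congr diag_mx; apply/rowP => i.
by rewrite !mxE rmorphM.
Qed.

Lemma rdiag_adj (R : realType) n (d : 'I_n -> R) : (rdiag d) ^t* = rdiag d.
Proof.
rewrite /rdiag tr_diag_mx map_diag_mx; congr diag_mx; apply/rowP => i.
by rewrite !mxE; apply: conjc_real.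
Qed.

Lemma nsq_rdiag (R : realType) n (d : 'I_n -> R) (u : 'cV[R[i]]_n) :
  nsq (rdiag d *m u) =
  \sum_i d i ^+ 2 * ((complex.Re (u i 0)) ^+ 2 + (complex.Im (u i 0)) ^+ 2).
Proof. by rewrite /nsq rdot_mulmxl mulmxA rdiag_adj rdiagM rdot_rdiag. Qed.

Lemma hermitian_rdiag (R : realType) n (H : 'M[R[i]]_n) : H ^t* = H ->
  exists (P : 'M[R[i]]_n) (d : 'I_n -> R),
    [/\ P \is unitarymx, H = P ^t* *m rdiag d *m P &
        forall j, eigenvalue H (d j)%:C].
Proof.
move=> /hermsymmx_adj hH; set P := spectralmx H.
have uP : P \is unitarymx by exact: spectral_unitarymx.
have [d hd] : exists d : 'I_n -> R, spectral_diag H = \row_j (d j)%:C.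
  exists (fun j => complex.Re (spectral_diag H 0 j)).
  apply/rowP => j; rewrite !mxE RRe_real //.
  exact: (mxOverP (hermitian_spectral_diag_real hH)).
exists P, d.
have e : H = P ^t* *m rdiag d *m P.
  by have /hermitian_normalmx/orthomx_spectralP := hH; rewrite hd invmx_unitary.
split=> // j; apply/eigenvalueP; exists (row j P).
  rewrite [X in _ *m X]e !mulmxA -row_mul (unitarymxP uP) -row_mul mul1mx.
  by rewrite row_diag_mx mxE -scalemxAl -rowE.
apply/eqP => /(congr1 (fun v => (v *m P ^t*) 0 j)).
rewrite -row_mul (unitarymxP uP) mul0mx !mxE eqxx => /eqP.
by rewrite oner_eq0.
Qed.

Lemma rdot_hermitian (R : realType) n (P : 'M[R[i]]_n) (d : 'I_n -> R) x :
  rdot x (P ^t* *m rdiag d *m P *m x) = rdot (P *m x) (rdiag d *m (P *m x)).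
Proof. by rewrite rdot_mulmxl !mulmxA. Qed.

(** * Eigenvalue counting and extremal eigenvectors *)

Lemma exists_mulmx_eq0 (F : fieldType) m n (M : 'M[F]_(m, n)) : (m < n)%N ->
  exists2 w : 'cV[F]_n, w != 0 & M *m w = 0.
Proof.
move=> mn; have : kermx M^T != 0.
  by rewrite kermx_eq0 /row_free neq_ltn (leq_ltn_trans (rank_leq_col M^T) mn).
rewrite -nz_row_eq0 => nz; exists (nz_row (kermx M^T))^T; first by rewrite trmx_eq0.
by apply: trmx_inj; rewrite trmx_mul trmxK trmx0; apply/sub_kermxP/nz_row_sub.
Qed.

Lemma sqr_ReIm_eq0 (R : realType) (z : R[i]) :
  ((complex.Re z) ^+ 2 + (complex.Im z) ^+ 2 == 0) = (z == 0).
Proof.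
case: z => a b /=; rewrite paddr_eq0 ?sqr_ge0 // !sqrf_eq0.
by rewrite [RHS]eq_complex.
Qed.

(** Courant-Fischer count: were there more than q eigenvalues above mu, some nonzero combination of
    their eigenvectors would satisfy the q equations C v = 0, and the form would exceed mu |v|^2
    there. *)
Lemma card_eigen_gt (R : realType) n q (L V : 'M[R[i]]_n) (lam : 'I_n -> R)
    (C : 'M[R[i]]_(q, n)) (mu : R) :
  V ^t* *m V = 1%:M -> L *m V = V *m rdiag lam ->
  (forall v, C *m v = 0 -> rdot v (L *m v) <= mu * nsq v) ->
  (#|[set j | (mu < lam j)%R]%SET| <= q)%N.
Proof.
move=> uV LV hC; set I := [set j | _]%SET; rewrite leqNgt; apply/negP => qI.
(* [E] extends a coefficient vector on [I] by zero to all indices. *)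
pose E : 'M[R[i]]_(n, #|I|) := colsub enum_val 1%:M.
have [w w0 CVEw] := exists_mulmx_eq0 (C *m V *m E) qI.
have Eout i : i \notin I -> (E *m w) i 0 = 0.
  move=> iI; rewrite mxE big1 // => j _; rewrite !mxE.
  by case: eqP => [e|]; rewrite ?mul0r //; case/negP: iI; rewrite e enum_valP.
have Ein j : (E *m w) (enum_val j) 0 = w j 0.
  rewrite mxE (bigD1 j) //= !mxE eqxx mul1r big1 ?addr0 // => l lj; rewrite !mxE.
  by rewrite (inj_eq enum_val_inj) eq_sym (negPf lj) mul0r.
have := hC (V *m (E *m w)); rewrite !mulmxA => /(_ CVEw).
rewrite LV -!mulmxA rdot_mulmxl [V ^t* *m _]mulmxA uV mul1mx rdot_rdiag nsq_isometry // nsqE.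
rewrite mulr_sumr -subr_le0 -sumrB => le0.
have ge0 i : 0 <= lam i * (complex.Re ((E *m w) i 0) ^+ 2 + complex.Im ((E *m w) i 0) ^+ 2)
   - mu * (complex.Re ((E *m w) i 0) ^+ 2 + complex.Im ((E *m w) i 0) ^+ 2).
  rewrite -mulrBl; have [iI|iI] := boolP (i \in I).
    rewrite mulr_ge0 //; last by rewrite addr_ge0 ?sqr_ge0.
    by rewrite subr_ge0 ltW //; rewrite inE in iI.
  by rewrite Eout //= expr0n /= addr0 mulr0.
(* Nonnegative terms with a nonpositive sum all vanish; on [I] the factor lam i - mu is positive, so
   w = 0. *)
have := le0; rewrite le_eqVlt ltNge sumr_ge0 // orbF psumr_eq0 // => /allP h.
case/eqP: w0; apply/matrixP => j z; rewrite ord1 -Ein [RHS]mxE; apply/eqP.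
have := h (enum_val j) (mem_index_enum _); rewrite -mulrBl mulf_eq0 sqr_ReIm_eq0.
case/orP => //; rewrite subr_eq0 => /eqP e.
by have := enum_valP j; rewrite inE e ltxx.
Qed.

(** [eigenvalue] speaks of row vectors; the adjoint of a left eigenvector of a Hermitian matrix is a
    right one for the same real eigenvalue. *)
Lemma eigenvalue_cV (R : realType) n (H : 'M[R[i]]_n) (x : R) : H ^t* = H ->
  eigenvalue H x%:C -> exists2 w : 'cV_n, w != 0 & H *m w = x%:C *: w.
Proof.
move=> hH /eigenvalueP[v hv v0]; exists (v ^t*); last first.
  rewrite -{1}hH -adjmxM hv; apply/matrixP => i j; rewrite !mxE rmorphM.
  by congr (_ * _); apply: conjc_real.
apply: contra v0 => /eqP e.
by rewrite -[v]trmxCK e trmx0 map_mx0.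
Qed.

Lemma min_eigenvector (R : realType) n (H : 'M[R[i]]_n) : (0 < n)%N -> H ^t* = H ->
  exists (s : R) (w : 'cV_n),
    [/\ nsq w = 1, H *m w = s%:C *: w & forall v, s * nsq v <= rdot v (H *m v)].
Proof.
move=> n0 hH; have [P [d [uP e _]]] := hermitian_rdiag hH.
case: n n0 H hH P d uP e => // n _ H hH P d uP e.
pose j := [arg min_(j < ord0) d j]%O; exists (d j), (P ^t* *m delta_mx j 0).
split.
- rewrite nsq_isometry ?trmxCK ?(unitarymxP uP) // nsqE (bigD1 j) //= !mxE eqxx /=.
  rewrite big1 ?addr0 ?expr1n ?expr0n ?addr0 // => i ij; rewrite mxE (negPf ij) /=.
  by rewrite expr0n addr0.
- rewrite e -!mulmxA [P *m _]mulmxA (unitarymxP uP) mul1mx scalemxAr; congr (_ *m _).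
  apply/matrixP => i z; rewrite ord1 rdiag_mulE !mxE.
  by case: eqP => [->|]; rewrite ?mulr0.
- move=> v; rewrite e rdot_hermitian rdot_rdiag -(nsq_isometry v (unitarymx_adj_mul uP)).
  rewrite nsqE mulr_sumr; apply: ler_sum => i _; apply: ler_wpM2r.
    by rewrite addr_ge0 ?sqr_ge0.
  by rewrite /j; case: arg_minP => // l _; apply.
Qed.

(** * Norm bounds, unitary splittings and adjoints *)

Lemma nsq_spectral_ge (R : realType) n (P : 'M[R[i]]_n) (d : 'I_n -> R) (D : R) v :
  P \is unitarymx -> (forall i, D <= d i ^+ 2) ->
  D * nsq v <= nsq (P ^t* *m rdiag d *m P *m v).
Proof.
move=> uP hD; rewrite -!mulmxA nsq_isometry ?trmxCK ?(unitarymxP uP) //.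
rewrite nsq_rdiag -(nsq_isometry v (unitarymx_adj_mul uP)) nsqE mulr_sumr.
by apply: ler_sum => i _; rewrite ler_wpM2r // addr_ge0 ?sqr_ge0.
Qed.

Lemma nsq_spectral_le (R : realType) n (P : 'M[R[i]]_n) (d : 'I_n -> R) (D : R) v :
  P \is unitarymx -> (forall i, d i ^+ 2 <= D) ->
  nsq (P ^t* *m rdiag d *m P *m v) <= D * nsq v.
Proof.
move=> uP hD; rewrite -!mulmxA nsq_isometry ?trmxCK ?(unitarymxP uP) //.
rewrite nsq_rdiag -(nsq_isometry v (unitarymx_adj_mul uP)) nsqE mulr_sumr.
by apply: ler_sum => i _; rewrite ler_wpM2r // addr_ge0 ?sqr_ge0.
Qed.

Lemma row_mx_unitary (R : realType) k m (Y1 : 'M[R[i]]_(k + m, k))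
    (Y2 : 'M[R[i]]_(k + m, m)) : row_mx Y1 Y2 \is unitarymx ->
  [/\ Y1 ^t* *m Y1 = 1%:M, Y2 ^t* *m Y2 = 1%:M, Y2 ^t* *m Y1 = 0 &
      Y1 *m Y1 ^t* + Y2 *m Y2 ^t* = 1%:M].
Proof.
move=> u; have := unitarymx_adj_mul u; move/unitarymxP: u.
rewrite tr_row_mx map_col_mx mul_row_col mul_col_row => ->.
by rewrite scalar_mx_block => /eq_block_mx[-> _ -> ->].
Qed.

Lemma nsq_row_mx_unitary (R : realType) k m (Y1 : 'M[R[i]]_(k + m, k))
    (Y2 : 'M[R[i]]_(k + m, m)) v : row_mx Y1 Y2 \is unitarymx ->
  nsq (Y1 ^t* *m v) + nsq (Y2 ^t* *m v) = nsq v.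
Proof.
move=> /row_mx_unitary[_ _ _ e].
by rewrite /nsq !rdot_mulmxl !trmxCK !mulmxA -rdotDr -mulmxDl e mul1mx.
Qed.

(** With z = B^H y one has |z|^2 = <y, B z>; Cauchy-Schwarz and the bound on B give |z|^4 <= r2
    |y|^2 |z|^2. *)
Lemma nsq_adj_le (R : realType) m n (B : 'M[R[i]]_(m, n)) (r2 : R) : 0 <= r2 ->
  (forall x, nsq (B *m x) <= r2 * nsq x) -> forall y, nsq (B ^t* *m y) <= r2 * nsq y.
Proof.
move=> r0 hB y; set z := B ^t* *m y.
have CS : nsq z ^+ 2 <= nsq y * nsq (B *m z).
  by rewrite {1}/nsq {1}/z rdot_mulmxl trmxCK rdot_CS.
have [z0|z0] := lerP (nsq z) 0; first by rewrite (le_trans z0) ?mulr_ge0 ?nsq_ge0.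
rewrite -(ler_pM2l z0) -expr2; apply: le_trans CS _.
by rewrite [leRHS]mulrC -mulrA -[leRHS]mulrCA ler_wpM2l ?nsq_ge0.
Qed.

(** * The spectral norm as an operator bound *)

Lemma spectral_norm_ge0 (R : realType) m n (S : 'M[R[i]]_(m, n)) :
  0 <= spectral_norm S.
Proof.
(* A set without a supremum gets the default value 0. *)
rewrite /spectral_norm; have [hs|/sup_out->//] := pselect (has_sup (singular_values S)).
have [[s hsv] _] := hs; have [s0 _] := hsv.
by apply: le_trans s0 _; apply: ub_le_sup => //; case: hs.
Qed.

Lemma singular_value_cV (R : realType) m n (S : 'M[R[i]]_(m, n)) s :
  singular_values S s ->
  exists2 w : 'cV_n, w != 0 & S ^t* *m S *m w = (s ^+ 2)%:C *: w.
Proof. by case=> _; apply: eigenvalue_cV; rewrite adjmxM trmxCK. Qed.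

Lemma nsq_mulmx_eigen (R : realType) m n (S : 'M[R[i]]_(m, n)) s w :
  S ^t* *m S *m w = s%:C *: w -> nsq (S *m w) = s * nsq w.
Proof. by move=> e; rewrite {1}/nsq rdot_mulmxr mulmxA e rdotZl. Qed.

(** In an eigenbasis of S^H S the square root of each eigenvalue is a singular value, hence at most
    the supremum once the set is known to be bounded. *)
Lemma nsq_spectral_norm (R : realType) m n (S : 'M[R[i]]_(m, n)) v :
  nsq (S *m v) <= spectral_norm S ^+ 2 * nsq v.
Proof.
have hH : (S ^t* *m S) ^t* = S ^t* *m S by rewrite adjmxM trmxCK.
have [P [d [uP e ev]]] := hermitian_rdiag hH.
have nS u : nsq (S *m u) =
    \sum_i d i * (complex.Re ((P *m u) i 0) ^+ 2 + complex.Im ((P *m u) i 0) ^+ 2).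
  by rewrite {1}/nsq rdot_mulmxl mulmxA e rdot_hermitian rdot_rdiag.
have nP u : nsq u =
    \sum_i (complex.Re ((P *m u) i 0) ^+ 2 + complex.Im ((P *m u) i 0) ^+ 2).
  by rewrite -nsqE nsq_isometry // unitarymx_adj_mul.
have d0 j : 0 <= d j.
  have [w w0 /nsq_mulmx_eigen hw] := eigenvalue_cV hH (ev j).
  have := nsq_ge0 (S *m w); rewrite hw pmulr_lge0 //.
  by rewrite lt_def nsq_eq0 w0 nsq_ge0.
(* A crude bound suffices: s^2 is at most the trace, and s <= 1 + s^2. *)
have bnd : ubound (singular_values S) (1 + \sum_i d i).
  move=> s hs; have [s0 _] := hs.
  have [w w0 /nsq_mulmx_eigen hw] := singular_value_cV hs.
  have {}w0 : 0 < nsq w by rewrite lt_def nsq_eq0 w0 nsq_ge0.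
  have h : s ^+ 2 <= \sum_i d i.
    rewrite -(ler_pM2r w0) -hw nS nP mulr_sumr; apply: ler_sum => i _.
    apply: ler_wpM2r; first by rewrite addr_ge0 ?sqr_ge0.
    by rewrite (bigD1 i) //= lerDl sumr_ge0.
  by have := sqr_ge0 (s - 1); nra.
rewrite nS nP mulr_sumr; apply: ler_sum => i _.
apply: ler_wpM2r; first by rewrite addr_ge0 ?sqr_ge0.
rewrite -[d i]sqr_sqrtr // ler_pXn2r ?nnegrE ?sqrtr_ge0 ?spectral_norm_ge0 //.
apply: ub_le_sup; first by exists (1 + \sum_i d i).
by split; [exact: sqrtr_ge0 | rewrite sqr_sqrtr].
Qed.

(** * Angle between the inner spectral subspace and the second block *)

Lemma nsq0 (R : realType) n : nsq (0 : 'cV[R[i]]_n) = 0.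
Proof. by apply/eqP; rewrite nsq_eq0. Qed.

Lemma nsqN (R : realType) n (u : 'cV[R[i]]_n) : nsq (- u) = nsq u.
Proof. by rewrite /nsq rdotNl rdotNr opprK. Qed.

Lemma rdot_ge (R : realType) n (u v : 'cV[R[i]]_n) :
  - (Num.sqrt (nsq u) * Num.sqrt (nsq v)) <= rdot u v.
Proof.
by rewrite lerNl -rdotNl -(nsqN u) rdot_le.
Qed.

Lemma sqrtr_le (R : rcfType) (x y : R) : 0 <= y -> x <= y ^+ 2 -> Num.sqrt x <= y.
Proof. by move=> y0 /ler_wsqrtr; rewrite sqrtr_sqr ger0_norm. Qed.

Lemma sqrtr_sqr_ge0 (R : rcfType) (x : R) : 0 <= x -> Num.sqrt (x ^+ 2) = x.
Proof. by move=> x0; rewrite sqrtr_sqr ger0_norm. Qed.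

(* [L] is the block matrix with diagonal [A1, A2] and lower left block [B]; the
   columns of [M1] over [M2] are orthonormal eigenvectors of [L] for the inner
   eigenvalues [lam]. *)
Lemma angle_bound (R : realType) k m (A1 : 'M[R[i]]_k) (A2 : 'M[R[i]]_m)
    (B : 'M[R[i]]_(m, k)) (M1 : 'M[R[i]]_(k, m)) (M2 : 'M[R[i]]_m)
    (lam : 'I_m -> R) (c d e r : R) :
  (0 < m)%N -> 0 <= c -> 0 < d -> 0 <= r -> 0 <= e -> e < d ->
  e ^+ 2 + d * e = r ^+ 2 ->
  A1 ^t* = A1 -> A2 ^t* = A2 ->
  (forall x, (c + d) ^+ 2 * nsq x <= nsq (A1 *m x)) ->
  (forall y, nsq (A2 *m y) <= c ^+ 2 * nsq y) ->
  (forall x, nsq (B *m x) <= r ^+ 2 * nsq x) ->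
  M1 ^t* *m M1 + M2 ^t* *m M2 = 1%:M ->
  A1 *m M1 + B ^t* *m M2 = M1 *m rdiag lam ->
  B *m M1 + A2 *m M2 = M2 *m rdiag lam ->
  (forall j, `|lam j| <= c + e) ->
  forall w, d ^+ 2 * nsq (M1 *m w) <= r ^+ 2 * nsq (M2 *m w).
Proof.
move=> m0 c0 d0 r0 e0 ed er hA1 hA2 hX hE hG hM hL1 hL2 hlam.
have nM w : nsq (M1 *m w) + nsq (M2 *m w) = nsq w.
  by rewrite /nsq !rdot_mulmxl !mulmxA -rdotDr -mulmxDl hM mul1mx.
have M1le w : nsq (M1 *m w) <= nsq w by rewrite -nM lerDl nsq_ge0.
have nL z : nsq (rdiag lam *m z) <= (c + e) ^+ 2 * nsq z.
  rewrite nsq_rdiag nsqE mulr_sumr; apply: ler_sum => i _.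
  apply: ler_wpM2r; first by rewrite addr_ge0 ?sqr_ge0.
  by rewrite -(real_normK (num_real (lam i))) ler_pXn2r ?nnegrE //; lra.
have L1 z : A1 *m (M1 *m z) + B ^t* *m (M2 *m z) = M1 *m (rdiag lam *m z).
  by rewrite !mulmxA -mulmxDl hL1.
have L2 z : B *m (M1 *m z) + A2 *m (M2 *m z) = M2 *m (rdiag lam *m z).
  by rewrite !mulmxA -mulmxDl hL2.
have hM2 : (M2 ^t* *m M2) ^t* = M2 ^t* *m M2 by rewrite adjmxM trmxCK.
(* s is the squared cosine of the largest angle, attained at [w0]. *)
have [s [w0 [w0n w0e smin]]] := min_eigenvector m0 hM2.
have smin2 z : s * nsq z <= nsq (M2 *m z).
  by rewrite {2}/nsq rdot_mulmxl mulmxA smin.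
have hw0 : nsq (M2 *m w0) = s by rewrite (nsq_mulmx_eigen w0e) w0n mulr1.
have hw0' : nsq (M1 *m w0) = 1 - s by rewrite -w0n -nM hw0 addrK.
have s1 : s <= 1 by rewrite -subr_ge0 -hw0' nsq_ge0.
(* If s = 0, then M w0 has only a first block, which L stretches by at least c + d, whereas L
   stretches the inner subspace by at most c + e < c + d. *)
have s0 : 0 < s.
  rewrite lt_def -{2}hw0 nsq_ge0 andbT; apply/eqP => sz.
  have y0 : M2 *m w0 = 0 by apply/eqP; rewrite -nsq_eq0 hw0 sz.
  have := hX (M1 *m w0); rewrite hw0' sz subr0 mulr1.
  have -> : A1 *m (M1 *m w0) = M1 *m (rdiag lam *m w0).
    by rewrite -L1 y0 mulmx0 addr0.
  move/le_trans => /(_ _ (M1le _)) /le_trans => /(_ _ (nL _)).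
  by rewrite w0n mulr1; nra.
(* The ratio |M1 w|^2 / |M2 w|^2 is at most (1 - s) / s, its value at [w0]. *)
suff main : d ^+ 2 * (1 - s) <= r ^+ 2 * s.
  move=> w; have h1 := smin2 w; have h2 := nM w.
  have h3 : nsq (M1 *m w) * s <= (1 - s) * nsq (M2 *m w).
    move: h1; rewrite -h2; move: (nsq (M1 *m w)) (nsq (M2 *m w)); clear; intros; lra.
  rewrite -(ler_pM2r s0) -mulrA.
  apply: (@le_trans _ _ (d ^+ 2 * ((1 - s) * nsq (M2 *m w)))).
    by rewrite ler_wpM2l ?sqr_ge0.
  have := ler_wpM2r (nsq_ge0 (M2 *m w)) main.
  move: (nsq (M2 *m w)); clear; intros; lra.
have [s1'|s1'] := lerP 1 s.
  apply: (@le_trans _ _ 0); last by rewrite mulr_ge0 ?sqr_ge0 // ltW.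
  by rewrite mulr_ge0_le0 ?sqr_ge0 // subr_le0.
pose q := Num.sqrt ((1 - s) / s).
have q2 : q ^+ 2 = (1 - s) / s.
  by rewrite sqr_sqrtr // divr_ge0 ?subr_ge0 // ltW.
have q0 : 0 < q by rewrite sqrtr_gt0 divr_gt0 // subr_gt0.
clearbody q.
have q2s : q ^+ 2 * s = 1 - s by rewrite q2 divfK // lt0r_neq0.
have sq : (1 + q ^+ 2) * s = 1 by move: q2s; clear; intros; lra.
suff : q * d <= r.
  move=> h; have h2 : (q * d) ^+ 2 <= r ^+ 2.
    by rewrite ler_pXn2r // nnegrE mulr_ge0 // ltW.
  have := ler_wpM2r (ltW s0) h2; rewrite exprMn -q2s; clear; intros; lra.
(* [q] is the tangent of the largest angle; the unit vectors [x, y] are chosen so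
   that [(q x, y)] lies in the range of [M] and [(x, - q y)] is orthogonal to it. *)
pose al := (Num.sqrt s)^-1; pose w := al%:C *: w0.
have al2 : al ^+ 2 = s^-1 by rewrite exprVn sqr_sqrtr // ltW.
pose y := M2 *m w; pose x := (q^-1)%:C *: (M1 *m w).
have xw : M1 *m w = q%:C *: x.
  by rewrite /x scalerA -rmorphM mulfV ?lt0r_neq0 // scale1r.
have wn : nsq w = s^-1 by rewrite nsqZ al2 w0n mulr1.
have yn : nsq y = 1.
  by rewrite /y /w -scalemxAr nsqZ hw0 al2 mulVf // lt0r_neq0.
have xn : nsq x = 1.
  rewrite /x nsqZ /w -scalemxAr nsqZ hw0' al2 exprVn -q2s.
  by rewrite [s^-1 * _]mulrC mulfK ?lt0r_neq0 // mulVf // expf_neq0 // lt0r_neq0.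
(* This holds because [w] is an eigenvector of both Gram matrices M1^H M1 and M2^H M2. *)
have orth z : rdot (M1 *m z) x = q * rdot (M2 *m z) y.
  have we : M2 ^t* *m M2 *m w = s%:C *: w.
    by rewrite /w -scalemxAr w0e !scalerA mulrC.
  have we' : M1 ^t* *m M1 *m w = (1 - s)%:C *: w.
    have -> : M1 ^t* *m M1 = 1%:M - M2 ^t* *m M2 by rewrite -hM addrK.
    by rewrite mulmxBl mul1mx we rmorphB scalerBl scale1r.
  rewrite !rdot_mulmxl /x /y -scalemxAr !mulmxA we we' !rdotZr -q2s.
  by field; rewrite lt0r_neq0.
pose a1 := A1 *m x; pose b1 := B *m x; pose a2 := A2 *m y; pose b2 := B ^t* *m y.
(* With u1 = M w, the vectors [M1 *m z] and [M2 *m z] are the two blocks of L u1. *)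
pose z := rdiag lam *m w.
have zx : M1 *m z = q%:C *: a1 + b2 by rewrite -L1 xw -scalemxAr.
have zy : M2 *m z = q%:C *: b1 + a2 by rewrite -L2 xw -scalemxAr.
pose X2 := nsq a1; pose G2 := nsq b1; pose E2 := nsq a2; pose H2 := nsq b2.
pose P := rdot b2 a1; pose T := rdot b1 a2.
have zzy : nsq (M2 *m z) = q ^+ 2 * G2 + 2 * q * T + E2.
  by rewrite zy nsqD nsqZ rdotZl mulrA.
have zzx : nsq (M1 *m z) = q ^+ 2 * X2 + 2 * q * P + H2.
  by rewrite zx nsqD nsqZ rdotZl mulrA [rdot a1 _]rdotC.
have hX2 : (c + d) ^+ 2 <= X2 by have := hX x; rewrite xn mulr1.
have hE2 : E2 <= c ^+ 2 by have := hE y; rewrite yn mulr1.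
have hG2 : G2 <= r ^+ 2 by have := hG x; rewrite xn mulr1.
have hH2 : H2 <= r ^+ 2.
  by have := nsq_adj_le (sqr_ge0 r) hG y; rewrite yn mulr1.
have o : q * (X2 + G2 - H2 - E2) + (1 - q ^+ 2) * (P + T) = 0.
  (* [L u1] and [L u2] are orthogonal for [u1 = (q x, y)] and [u2 = (x, - q y)],
     because [L (L u1)] stays in the range of [M]. *)
  have := orth (rdiag lam *m z).
  rewrite -L1 -L2 zx zy !rdotDl !rdot_mulmxl hA1 hA2 trmxCK -/a1 -/a2 -/b1 -/b2.
  rewrite !rdot_lin -!/(nsq _) (rdotC a1 b2) (rdotC a2 b1) -/X2 -/G2 -/H2 -/E2 -/P -/T.
  clearbody X2 G2 H2 E2 P T; clear; intros; lra.
have hPT : - (Num.sqrt H2 * Num.sqrt X2 + Num.sqrt E2 * Num.sqrt G2) <= P + T.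
  by rewrite opprD lerD ?rdot_ge // mulrC rdot_ge.
have hzc : q * T + E2 <= c * Num.sqrt (nsq (M2 *m z)).
  have -> : q * T + E2 = rdot a2 (M2 *m z).
    by rewrite zy rdotDr rdotZr [rdot a2 b1]rdotC.
  apply: le_trans (rdot_le _ _) _; apply: ler_wpM2r; first exact: sqrtr_ge0.
  exact: sqrtr_le.
(* Maximality of q, in the form s |z|^2 <= |M2 z|^2. *)
have hzq : nsq (M1 *m z) <= q ^+ 2 * nsq (M2 *m z).
  rewrite -(ler_pM2r s0) mulrAC q2s; move: (smin2 z); rewrite -nM.
  move: (nsq (M1 *m z)) (nsq (M2 *m z)); clear; intros; lra.
have hze : nsq (M1 *m z) + nsq (M2 *m z) <= (1 + q ^+ 2) * (c + e) ^+ 2.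
  rewrite nM [leRHS]mulrC; have -> : 1 + q ^+ 2 = nsq w.
    by apply: (mulIf (lt0r_neq0 s0)); rewrite sq wn mulVf // lt0r_neq0.
  exact: nL.
have [X20 G20 H20 E20] : [/\ 0 <= X2, 0 <= G2, 0 <= H2 & 0 <= E2].
  by split; exact: nsq_ge0.
have y20 := nsq_ge0 (M2 *m z).
move: (nsq (M1 *m z)) (nsq (M2 *m z)) zzx zzy hzc hzq hze y20 => x2 y2.
clearbody X2 G2 H2 E2 P T; move=> *.
case: (lerP q 1) => q1.
  apply: (@tangent_le1_bound _ c d r q (Num.sqrt X2) (Num.sqrt H2) (Num.sqrt G2)
    (Num.sqrt E2) (P + T)); rewrite ?sqrtr_ge0 ?sqr_sqrtr ?sqrtr_le //.
  by rewrite -[leLHS]sqrtr_sqr_ge0 ?ler_wsqrtr // addr_ge0 // ltW.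
by apply: (@tangent_ge1_bound _ c d e r q X2 H2 G2 E2 P T y2 (Num.sqrt y2) x2);
  rewrite ?sqrtr_ge0 ?sqr_sqrtr // ltW.
Qed.

(** * Complementary subspaces and principal angles *)

(** Transfers the bound from the second blocks to their complements. The square matrix Q2^H X2 is
    invertible and its inverse has squared norm at most 1 + t, as has the adjoint of the inverse;
    hence |X1^H Q2 v|^2 <= t / (1 + t) |v|^2. Passing to the adjoint Q2^H X1 and then to the
    complement Q1 concludes. *)
Lemma angle_bound_compl (R : realType) k m (Q1 X1 : 'M[R[i]]_(k + m, k))
    (Q2 X2 : 'M[R[i]]_(k + m, m)) (t : R) : 0 <= t ->
  row_mx Q1 Q2 \is unitarymx -> row_mx X1 X2 \is unitarymx ->
  (forall w, nsq (Q1 ^t* *m (X2 *m w)) <= t * nsq (Q2 ^t* *m (X2 *m w))) ->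
  forall u, nsq u <= (1 + t) * nsq (Q1 ^t* *m (X1 *m u)).
Proof.
move=> t0 uQ uX h u.
have t1 : 0 < 1 + t by rewrite ltr_wpDr.
have [Q11 Q22 _ _] := row_mx_unitary uQ; have [X11 X22 _ _] := row_mx_unitary uX.
pose M2 := Q2 ^t* *m X2.
have M2ge w : nsq w <= (1 + t) * nsq (M2 *m w).
  have := h w; have := nsq_row_mx_unitary (X2 *m w) uQ; rewrite (nsq_isometry w X22) -mulmxA.
  move: (nsq (Q1 ^t* *m _)) (nsq (Q2 ^t* *m _)) (nsq w); clear=> ? ? _ <- ?; lra.
have M2u : M2 \in unitmx.
  rewrite -unitmx_tr -row_free_unit -kermx_eq0; apply/rowV0P => v /sub_kermxP e.
  apply: trmx_inj; apply/eqP; rewrite trmx0 -nsq_eq0 eq_le nsq_ge0 andbT.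
  apply: le_trans (M2ge _) _.
  by rewrite -[M2 *m _]trmxK trmx_mul trmxK e trmx0 nsq0 mulr0.
have M2inv y : nsq (invmx M2 *m y) <= (1 + t) * nsq y.
  by have := M2ge (invmx M2 *m y); rewrite mulKVmx.
have M2a v : nsq v <= (1 + t) * nsq (X2 ^t* *m (Q2 *m v)).
  have := nsq_adj_le (ltW t1) M2inv (M2 ^t* *m v).
  rewrite mulmxA -adjmxM (mulmxV M2u) trmx1 map_mx1 mul1mx /M2 adjmxM trmxCK.
  by rewrite -mulmxA.
have M21a v : nsq ((Q2 ^t* *m X1) ^t* *m v) <= t / (1 + t) * nsq v.
  rewrite mulrAC ler_pdivlMr // adjmxM trmxCK -mulmxA.
  have := M2a v; have := nsq_row_mx_unitary (Q2 *m v) uX; rewrite (nsq_isometry v Q22).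
  by move: (nsq (X1 ^t* *m _)) (nsq (X2 ^t* *m _)) (nsq v); clear=> ? ? _ <- ?; lra.
have t2 : 0 <= t / (1 + t) by rewrite divr_ge0 // ltW.
have := nsq_adj_le t2 M21a u; rewrite trmxCK -mulmxA mulrAC ler_pdivlMr //.
have := nsq_row_mx_unitary (X1 *m u) uQ; rewrite (nsq_isometry u X11).
by move: (nsq (Q1 ^t* *m _)) (nsq (Q2 ^t* *m _)) (nsq u); clear=> ? ? _ <- ?; lra.
Qed.

Lemma colspan_sub (R : realType) n p q (P : 'M[R[i]]_(n, p)) (Q : 'M[R[i]]_(n, q)) :
  (colspan P <= colspan Q)%VS -> exists Z, P = Q *m Z.
Proof.
move=> PQ; have Qimg : (colspan Q <= limg (linfun (mulmx Q : 'cV_q -> 'cV_n)))%VS.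
  apply/span_subvP => v /mapP[j _ ->]; rewrite colE.
  have := memv_img (linfun (mulmx Q : 'cV_q -> 'cV_n)) (memvf (delta_mx j 0)).
  by rewrite lfunE.
have ex j : {z : 'cV_q | col j P == Q *m z}.
  apply: sigW; have : col j P \in limg (linfun (mulmx Q : 'cV_q -> 'cV_n)).
    apply: (subvP Qimg); apply: (subvP PQ); apply: memv_span.
    by apply/mapP; exists j; rewrite ?mem_enum.
  by case/memv_imgP => z _ ->; exists z; rewrite lfunE.
exists (\matrix_(i, j) sval (ex j) i 0); apply/matrixP => i j.
have /eqP/matrixP/(_ i 0) := svalP (ex j); rewrite !mxE => ->.
by apply: eq_bigr => l _; rewrite !mxE.
Qed.

(** The orthogonal projection depends only on the subspace: each projection fixes the other basis,
    and taking the adjoint of one of these identities yields equality. This makes principal angles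
    independent of the bases. *)
Lemma colspan_proj (R : realType) n p q (P : 'M[R[i]]_(n, p)) (Q : 'M[R[i]]_(n, q)) :
  colspan P = colspan Q -> P ^t* *m P = 1%:M -> Q ^t* *m Q = 1%:M ->
  P *m P ^t* = Q *m Q ^t*.
Proof.
move=> PQ uP uQ.
have [|Z PZ] := @colspan_sub _ _ _ _ P Q; first by rewrite PQ.
have [|Y QY] := @colspan_sub _ _ _ _ Q P; first by rewrite PQ.
have e1 : Q *m Q ^t* *m P = P by rewrite {1}PZ !mulmxA -[Q *m _ *m Q]mulmxA uQ mulmx1 -PZ.
have e2 : P *m P ^t* *m Q = Q by rewrite {1}QY !mulmxA -[P *m _ *m P]mulmxA uP mulmx1 -QY.
have e3 : P ^t* *m (Q *m Q ^t*) = P ^t*.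
  by rewrite -[in RHS]e1 !adjmxM trmxCK !mulmxA.
by rewrite -[in LHS]e3 !mulmxA e2.
Qed.

Lemma nsq_proj (R : realType) n p q (P : 'M[R[i]]_(n, p)) (Q : 'M[R[i]]_(n, q)) v :
  P *m P ^t* = Q *m Q ^t* -> nsq (P ^t* *m v) = nsq (Q ^t* *m v).
Proof. by move=> e; rewrite /nsq !rdot_mulmxl !trmxCK !mulmxA e. Qed.

(** Each cosine s satisfies (1 + t^2) s^2 >= 1, that is s >= cos (atan t), so every principal angle
    is at most atan t, and so is their supremum. *)
Lemma tan_largest_angle_le (R : realType) n k (Q X : 'M[R[i]]_(n, k)) (t : R) :
  0 <= t -> Q ^t* *m Q = 1%:M -> X ^t* *m X = 1%:M ->
  (forall u, nsq u <= (1 + t ^+ 2) * nsq (Q ^t* *m (X *m u))) ->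
  largest_angle (colspan Q) (colspan X) < pi / 2 /\
  tan (largest_angle (colspan Q) (colspan X)) <= t.
Proof.
move=> t0 uQ uX h.
have t1 : 0 < 1 + t ^+ 2 by rewrite ltr_wpDr ?sqr_ge0.
have at0 : 0 <= atan t by rewrite -atan0 le_atan.
have ang th : principal_angles (colspan Q) (colspan X) th -> 0 <= th <= atan t.
  move=> [p [P [W [[uP PQ] [uW WX] [s hs ->]]]]]; have [s0 _] := hs.
  have [w w0 /nsq_mulmx_eigen e] := singular_value_cV hs.
  have wn : 0 < nsq w by rewrite lt_def nsq_eq0 w0 nsq_ge0.
  have [|Z WZ] := @colspan_sub _ _ _ _ W X; first by rewrite WX.
  have Zn : nsq (Z *m w) = nsq w.
    by rewrite -(nsq_isometry (Z *m w) uX) mulmxA -WZ nsq_isometry.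
  have eQ : nsq (Q ^t* *m (X *m (Z *m w))) = s ^+ 2 * nsq w.
    rewrite -(nsq_proj _ (colspan_proj PQ uP uQ)) -e WZ.
    by rewrite !mulmxA.
  have ge : 1 <= (1 + t ^+ 2) * s ^+ 2.
    by rewrite -(ler_pM2r wn) mul1r -mulrA -eQ -{1}Zn h.
  (* [acos] inverts [cos] only on [-1, 1]. *)
  have le1 : s ^+ 2 <= 1.
    have r10 : (0:R) <= 1 by [].
    have PP x : nsq (P *m x) <= 1 * nsq x by rewrite nsq_isometry // mul1r.
    have := nsq_adj_le r10 PP (W *m w); rewrite mulmxA e nsq_isometry // mul1r.
    by rewrite ger_pMl.
  have s1 : s <= 1 by rewrite -(@ler_pXn2r _ 2) ?nnegrE // expr1n.
  have sB : -1 <= s <= 1 by rewrite s1 andbT (le_trans _ s0) // oppr_le0.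
  rewrite acos_ge0 //= leNgt; apply/negP => lt.
  have [/andP[a0 api] ca] := acos_def sB.
  have : cos (acos s) < cos (atan t).
    rewrite ltr_cos // in_itv /= ?a0 ?api // at0.
    by rewrite (le_trans (ltW (atan_ltpi2 t))) // ler_piMr ?pi_ge0 // invf_le1 // ler1n.
  rewrite ca cos_atan => lts.
  have : s ^+ 2 < (1 + t ^+ 2)^-1.
    rewrite -[ltRHS]sqr_sqrtr ?invr_ge0 ?(ltW t1) // sqrtrV ?(ltW t1) //.
    by rewrite ltr_pXn2r // nnegrE invr_ge0 sqrtr_ge0.
  by rewrite -[ltRHS]mul1r ltr_pdivlMr // mulrC ltNge ge.
have [l0 lt] : 0 <= largest_angle (colspan Q) (colspan X) /\
    largest_angle (colspan Q) (colspan X) <= atan t.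
  rewrite /largest_angle.
  (* An empty set of angles has supremum 0, which obeys both bounds. *)
  have [[x hx]|/set0P/negP/negPn/eqP->] :=
    pselect (principal_angles (colspan Q) (colspan X) !=set0).
    have ub : ubound (principal_angles (colspan Q) (colspan X)) (atan t).
      by move=> y /ang/andP[].
    split; last by apply: ge_sup => //; exists x.
    have /andP[x0 _] := ang _ hx; apply: le_trans x0 _.
    by apply: ub_le_sup => //; exists (atan t).
  by rewrite sup0.
have lt2 := le_lt_trans lt (atan_ltpi2 t); split=> //.
rewrite -[leRHS]atanK leNgt ltr_tan ?in_itv /= ?lt2 ?atan_ltpi2 ?atan_gtNpi2 //.
  by rewrite -leNgt.
by rewrite andbT (lt_le_trans _ l0) // oppr_lt0 divr_gt0 // pi_gt0.
Qed.

(** * Counting outer and inner eigenvalues *)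

(** The constraints kill the components of Q1^H v along eigenvectors of A1 with positive eigenvalue.
    On what remains A1 is at most - (c + d), and [gap_form_le] with p = |x|, q = |y| bounds the form
    of L by c + e. *)
Lemma card_eigen_outer_gt (R : realType) k m (L V : 'M[R[i]]_(k + m))
    (Q1 : 'M[R[i]]_(k + m, k)) (Q2 : 'M[R[i]]_(k + m, m)) (lam : 'I_(k + m) -> R)
    (P : 'M[R[i]]_k) (al : 'I_k -> R) (c d e r : R) :
  L ^t* = L -> row_mx Q1 Q2 \is unitarymx ->
  V ^t* *m V = 1%:M -> L *m V = V *m rdiag lam ->
  0 <= c -> 0 < d -> 0 <= r -> 0 <= e -> e ^+ 2 + d * e = r ^+ 2 ->
  P \is unitarymx -> Q1 ^t* *m L *m Q1 = P ^t* *m rdiag al *m P ->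
  (forall i, c + d <= `|al i|) ->
  (forall y, nsq (Q2 ^t* *m L *m Q2 *m y) <= c ^+ 2 * nsq y) ->
  (forall x, nsq (Q2 ^t* *m L *m Q1 *m x) <= r ^+ 2 * nsq x) ->
  (#|[set j | (c + e < lam j)%R]%SET| <= #|[set i | (0 < al i)%R]%SET|)%N.
Proof.
move=> hL uQ uV LV c0 d0 r0 e0 er uP eA1 hal hA2 hB.
set Ip := [set i | (0 < al i)%R]%SET.
apply: (@card_eigen_gt _ _ _ L V lam
  (\matrix_(i < #|Ip|) row (enum_val i) (P *m Q1 ^t*)) (c + e)) => // v Cv.
have [_ _ _ QQ] := row_mx_unitary uQ.
set x := Q1 ^t* *m v; set y := Q2 ^t* *m v.
have vE : v = Q1 *m x + Q2 *m y by rewrite !mulmxA -mulmxDl QQ mul1mx.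
have nv : nsq v = nsq x + nsq y by rewrite (nsq_row_mx_unitary v uQ).
have Px0 i : 0 < al i -> (P *m x) i 0 = 0.
  move=> ai; have iI : i \in Ip by rewrite inE.
  have := congr1 (fun M : 'cV_#|Ip| => M (enum_rank_in iI i) 0) Cv.
  rewrite [in RHS]mxE => <-; rewrite mulmxA !mxE; apply: eq_bigr => j _.
  by rewrite !mxE enum_rankK_in //.
have hx : rdot x (Q1 ^t* *m L *m Q1 *m x) <= - (c + d) * nsq x.
  rewrite eA1 rdot_hermitian rdot_rdiag -(nsq_isometry x (unitarymx_adj_mul uP)).
  rewrite nsqE mulr_sumr; apply: ler_sum => i _.
  have [ai|ai] := ltP 0 (al i); first by rewrite Px0 //= expr0n /= addr0 !mulr0.
  apply: ler_wpM2r; first by rewrite addr_ge0 ?sqr_ge0.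
  by have := hal i; rewrite ler0_norm // lerNr.
have hy : rdot y (Q2 ^t* *m L *m Q2 *m y) <= c * nsq y.
  have -> : c * nsq y = Num.sqrt (nsq y) * (c * Num.sqrt (nsq y)).
    by rewrite mulrCA -expr2 sqr_sqrtr ?nsq_ge0.
  apply: le_trans (rdot_le _ _) _; apply: ler_wpM2l; first exact: sqrtr_ge0.
  apply: sqrtr_le; first by rewrite mulr_ge0 ?sqrtr_ge0.
  by rewrite exprMn sqr_sqrtr ?nsq_ge0.
have hxy : rdot y (Q2 ^t* *m L *m Q1 *m x) <= r * Num.sqrt (nsq x) * Num.sqrt (nsq y).
  apply: le_trans (rdot_le _ _) _; rewrite mulrC; apply: ler_wpM2r; first exact: sqrtr_ge0.
  apply: sqrtr_le; first by rewrite mulr_ge0 ?sqrtr_ge0.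
  by rewrite exprMn sqr_sqrtr ?nsq_ge0.
have -> : rdot v (L *m v) = rdot x (Q1 ^t* *m L *m Q1 *m x) +
    2 * rdot y (Q2 ^t* *m L *m Q1 *m x) + rdot y (Q2 ^t* *m L *m Q2 *m y).
  have xy : rdot x (Q1 ^t* *m L *m Q2 *m y) = rdot y (Q2 ^t* *m L *m Q1 *m x).
    by rewrite rdotC rdot_mulmxl !adjmxM trmxCK hL !mulmxA.
  have dv w : rdot v w = rdot x (Q1 ^t* *m w) + rdot y (Q2 ^t* *m w).
    by rewrite -!rdot_mulmxl -rdotDl -vE.
  have Lv : L *m v = L *m (Q1 *m x) + L *m (Q2 *m y) by rewrite -mulmxDr -vE.
  clearbody x y; rewrite dv Lv !mulmxDr !mulmxA !rdotDr xy.
  by rewrite mulr2n mulrDl mul1r !addrA.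
rewrite nv; apply: (@le_trans _ _ (- (c + d) * nsq x +
  2 * (r * Num.sqrt (nsq x) * Num.sqrt (nsq y)) + c * nsq y)).
  by rewrite !lerD // ler_wpM2l.
have := @gap_form_le R c d e r (Num.sqrt (nsq x)) (Num.sqrt (nsq y)) c0 d0 r0 e0 er.
by rewrite !sqr_sqrtr ?nsq_ge0.
Qed.

(** The one-sided count is applied to L and to - L; A1 has at most k positive and negative
    eigenvalues altogether. *)
Lemma card_eigen_outer (R : realType) k m (L V : 'M[R[i]]_(k + m))
    (Q1 : 'M[R[i]]_(k + m, k)) (Q2 : 'M[R[i]]_(k + m, m)) (lam : 'I_(k + m) -> R)
    (P : 'M[R[i]]_k) (al : 'I_k -> R) (c d e r : R) :
  L ^t* = L -> row_mx Q1 Q2 \is unitarymx ->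
  V ^t* *m V = 1%:M -> L *m V = V *m rdiag lam ->
  0 <= c -> 0 < d -> 0 <= r -> 0 <= e -> e ^+ 2 + d * e = r ^+ 2 ->
  P \is unitarymx -> Q1 ^t* *m L *m Q1 = P ^t* *m rdiag al *m P ->
  (forall i, c + d <= `|al i|) ->
  (forall y, nsq (Q2 ^t* *m L *m Q2 *m y) <= c ^+ 2 * nsq y) ->
  (forall x, nsq (Q2 ^t* *m L *m Q1 *m x) <= r ^+ 2 * nsq x) ->
  (#|[set j | (c + e < `|lam j|)%R]%SET| <= k)%N.
Proof.
move=> hL uQ uV LV c0 d0 r0 e0 er uP eA1 hal hA2 hB.
have rdiagN n (f : 'I_n -> R) : rdiag (fun i => - f i) = - rdiag f.
  apply/matrixP => i j; rewrite !mxE.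
  by case: eqP => // _; rewrite ?mulr1n ?mulr0n ?oppr0 // rmorphN.
have h1 := card_eigen_outer_gt hL uQ uV LV c0 d0 r0 e0 er uP eA1 hal hA2 hB.
have hLN : (- L) ^t* = - L by rewrite linearN map_mxN hL.
have LVN : - L *m V = V *m rdiag (fun j => - lam j) by rewrite rdiagN mulNmx mulmxN LV.
have eAN : Q1 ^t* *m - L *m Q1 = P ^t* *m rdiag (fun i => - al i) *m P.
  by rewrite rdiagN !mulmxN !mulNmx eA1.
have halN i : c + d <= `|- al i| by rewrite normrN.
have hAN y : nsq (Q2 ^t* *m - L *m Q2 *m y) <= c ^+ 2 * nsq y.
  by rewrite mulmxN !mulNmx nsqN.
have hBN x : nsq (Q2 ^t* *m - L *m Q1 *m x) <= r ^+ 2 * nsq x.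
  by rewrite mulmxN !mulNmx nsqN.
have h2 := card_eigen_outer_gt hLN uQ uV LVN c0 d0 r0 e0 er uP eAN halN hAN hBN.
have h3 : (#|[set i | (0 < al i)%R]%SET| + #|[set i | (0 < - al i)%R]%SET| <= k)%N.
  rewrite -cardsUI (_ : _ :&: _ = finset.set0)%SET; last first.
    apply/setP => i; rewrite !inE; case: ltrP => //= h.
    by rewrite oppr_gt0 ltNge (ltW h).
  by rewrite cards0 addn0 -[leqRHS]card_ord max_card.
apply: leq_trans h3; apply: leq_trans (leq_add h1 h2); rewrite -cardsUI.
have sub : [set j | (c + e < `|lam j|)%R]%SET \subset
    ([set j | (c + e < lam j)%R] :|: [set j | (c + e < - lam j)%R])%SET.
  by apply/fintype.subsetP => j; rewrite !inE ltr_normr.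
exact: leq_trans (subset_leq_card sub) (leq_addr _ _).
Qed.

(** The count is applied to - L^2 with threshold - D^2 and constraints Q2^H v = 0: on the range of
    Q1, |L v| >= |Q1^H L v| >= D |v|. *)
Lemma card_eigen_inner (R : realType) k m (L V : 'M[R[i]]_(k + m))
    (Q1 : 'M[R[i]]_(k + m, k)) (Q2 : 'M[R[i]]_(k + m, m)) (lam : 'I_(k + m) -> R)
    (D : R) :
  L ^t* = L -> row_mx Q1 Q2 \is unitarymx ->
  V ^t* *m V = 1%:M -> L *m V = V *m rdiag lam -> 0 <= D ->
  (forall x, D ^+ 2 * nsq x <= nsq (Q1 ^t* *m L *m Q1 *m x)) ->
  (#|[set j | (`|lam j| < D)%R]%SET| <= m)%N.
Proof.
move=> hL uQ uV LV D0 hA1.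
have [_ _ _ QQ] := row_mx_unitary uQ.
have -> : [set j | (`|lam j| < D)%R]%SET = [set j | (- D ^+ 2 < - (lam j * lam j))%R]%SET.
  apply/setP => j; rewrite !inE ltrN2 -expr2 -(real_normK (num_real (lam j))).
  by rewrite ltr_pXn2r.
apply: (@card_eigen_gt _ _ _ (- (L *m L)) V _ (Q2 ^t*) (- D ^+ 2)) => // [|v Qv].
  have -> : rdiag (fun j => - (lam j * lam j)) = - (rdiag lam *m rdiag lam).
    rewrite rdiagM; apply/matrixP => i j; rewrite !mxE.
    by case: eqP => // _; rewrite ?mulr1n ?mulr0n ?oppr0 // rmorphN.
  by rewrite mulNmx mulmxN -mulmxA LV !mulmxA LV.
have vE : v = Q1 *m (Q1 ^t* *m v).
  by rewrite -[LHS]mul1mx -QQ mulmxDl -!mulmxA Qv mulmx0 addr0.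
rewrite mulNmx rdotNr mulNr lerN2 -mulmxA rdot_mulmxr hL -/(nsq _).
rewrite -(nsq_row_mx_unitary v uQ) Qv nsq0 addr0.
apply: le_trans (hA1 _) _; rewrite -!mulmxA -vE.
by rewrite -(nsq_row_mx_unitary (L *m v) uQ) lerDl nsq_ge0.
Qed.

(** * Reordering and diagonalizing eigenvectors *)

Lemma exists_perm_split k m (J : {set 'I_(k + m)}) : #|J| = m ->
  exists s : 'S_(k + m), (forall i, s (lshift m i) \notin J) /\
                         (forall j, s (rshift k j) \in J).
Proof.
move=> Jm; have Jk : #|(~: J)%SET| = k.
  by have := cardsC J; rewrite Jm card_ord addnC => /addIn.
pose f i := match split i with
  | inl a => enum_val (cast_ord (esym Jk) a)
  | inr b => enum_val (cast_ord (esym Jm) b)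
  end.
have fl a : f (lshift m a) = enum_val (cast_ord (esym Jk) a).
  by rewrite /f; have := unsplitK (inl a); rewrite /unsplit => ->.
have fr b : f (rshift k b) = enum_val (cast_ord (esym Jm) b).
  by rewrite /f; have := unsplitK (inr b); rewrite /unsplit => ->.
have inl_ a : f (lshift m a) \notin J.
  by rewrite fl; have := enum_valP (cast_ord (esym Jk) a); rewrite inE.
have inr_ b : f (rshift k b) \in J by rewrite fr; exact: enum_valP.
have inj : injective f.
  move=> x y; rewrite -(splitK x) -(splitK y).
  case: (split x) (split y) => [a|b] [a'|b'] /=.
  - by rewrite !fl => /enum_val_inj/cast_ord_inj->.
  - by move=> h; have := inl_ a; rewrite h inr_.
  - by move=> h; have := inl_ a'; rewrite -h inr_.
  - by rewrite !fr => /enum_val_inj/cast_ord_inj->.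
by exists (perm inj); split=> i; rewrite permE.
Qed.

Lemma eigenvalue_rdiag (R : realType) n (f : 'I_n -> R) z :
  eigenvalue (rdiag f) z -> exists i, z = (f i)%:C.
Proof.
move=> /eigenvalueP[v hv v0]; have /rV0Pn[i vi] := v0.
exists i; have /rowP/(_ i) := hv; rewrite mul_mx_diag !mxE mulrC.
by move/(mulIf vi).
Qed.

Lemma orthonormal_eigenvectors_rdiag (R : realType) n (A V : 'M[R[i]]_n) :
  A ^t* = A -> orthonormal_eigenvectors A V ->
  exists lam : 'I_n -> R, A *m V = V *m rdiag lam.
Proof.
move=> hA [uV /choice[l hl]].
have AV : A *m V = V *m diag_mx (\row_j l j).
  apply/matrixP => i j; have /matrixP/(_ i 0) := hl j.
  rewrite mul_mx_diag !mxE [RHS]mulrC => <-.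
  by apply: eq_bigr => x _; rewrite mxE.
have dE : diag_mx (\row_j l j) = V ^t* *m A *m V.
  by rewrite -mulmxA AV mulmxA unitarymx_adj_mul // mul1mx.
have lr j : l j \is Num.real.
  have : (diag_mx (\row_j l j)) ^t* = diag_mx (\row_j l j).
    by rewrite dE !adjmxM trmxCK hA mulmxA.
  by move=> /matrixP/(_ j j); rewrite !mxE eqxx mulr1n => /CrealP.
exists (fun j => complex.Re (l j)); rewrite AV; congr (_ *m _).
by rewrite /rdiag; congr diag_mx; apply/rowP => j; rewrite !mxE RRe_real.
Qed.

Lemma rdiag_block (R : realType) k m (f : 'I_(k + m) -> R) :
  rdiag f = block_mx (rdiag (fun i => f (lshift m i))) 0 0
                     (rdiag (fun j => f (rshift k j))).
Proof.
by rewrite /rdiag -diag_mx_row; congr diag_mx; apply/rowP => i; rewrite !mxE;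
  case: split_ordP => j ->; rewrite mxE.
Qed.

Lemma col_perm_unitary (R : realType) n (s : 'S_n) (V : 'M[R[i]]_n) :
  V \is unitarymx -> col_perm s V \is unitarymx.
Proof.
move=> uV; rewrite col_permE; apply: (mul_unitarymx uV); apply/unitarymxP.
by rewrite tr_perm_mx map_perm_mx -perm_mxM mulgV perm_mx1.
Qed.

Lemma col_perm_rdiag (R : realType) n (s : 'S_n) (A V : 'M[R[i]]_n) lam :
  A *m V = V *m rdiag lam ->
  A *m col_perm s V = col_perm s V *m rdiag (fun j => lam (s j)).
Proof.
move=> AV; have -> : A *m col_perm s V = col_perm s (A *m V).
  by rewrite !col_permE mulmxA.
by rewrite AV; apply/matrixP => i j; rewrite mxE !mul_mx_diag !mxE.
Qed.

(** * The centred problem and the theorem *)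

(** Centred form of the result: with the midpoint of [a, b] moved to 0, both spectral conditions
    become bounds on absolute values. *)
Lemma spectral_gap_split (R : realType) k m (L V : 'M[R[i]]_(k + m))
    (Q1 : 'M[R[i]]_(k + m, k)) (Q2 : 'M[R[i]]_(k + m, m)) (lam : 'I_(k + m) -> R)
    (P1 : 'M[R[i]]_k) (al : 'I_k -> R) (P2 : 'M[R[i]]_m) (be : 'I_m -> R)
    (c d e r : R) :
  (0 < m)%N -> L ^t* = L -> row_mx Q1 Q2 \is unitarymx ->
  V \is unitarymx -> L *m V = V *m rdiag lam ->
  0 <= c -> 0 < d -> 0 <= r -> 0 <= e -> e < d -> e ^+ 2 + d * e = r ^+ 2 ->
  P1 \is unitarymx -> Q1 ^t* *m L *m Q1 = P1 ^t* *m rdiag al *m P1 ->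
  (forall i, c + d <= `|al i|) ->
  P2 \is unitarymx -> Q2 ^t* *m L *m Q2 = P2 ^t* *m rdiag be *m P2 ->
  (forall i, `|be i| <= c) ->
  (forall x, nsq (Q2 ^t* *m L *m Q1 *m x) <= r ^+ 2 * nsq x) ->
  exists s : 'S_(k + m),
    [/\ forall i, c + d <= `|lam (s (lshift m i))|,
        forall j, `|lam (s (rshift k j))| <= c + e &
        let X := col_perm s V in
        largest_angle (colspan Q1) (colspan (lsubmx X)) < pi / 2 /\
        tan (largest_angle (colspan Q1) (colspan (lsubmx X))) <= r / d].
Proof.
move=> m0 hL uQ uV LV c0 d0 r0 e0 ed er uP1 eA1 hal uP2 eA2 hbe hB.
have cd0 : 0 <= c + d by rewrite addr_ge0 // ltW.
have V1 := unitarymx_adj_mul uV.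
have hA1 x : (c + d) ^+ 2 * nsq x <= nsq (Q1 ^t* *m L *m Q1 *m x).
  rewrite eA1; apply: nsq_spectral_ge => // i.
  by rewrite -[al i ^+ 2](real_normK (num_real _)) ler_pXn2r ?nnegrE.
have hA2 y : nsq (Q2 ^t* *m L *m Q2 *m y) <= c ^+ 2 * nsq y.
  rewrite eA2; apply: nsq_spectral_le => // i.
  by rewrite -[be i ^+ 2](real_normK (num_real _)) ler_pXn2r ?nnegrE.
have := card_eigen_outer hL uQ V1 LV c0 d0 r0 e0 er uP1 eA1 hal hA2 hB.
have := card_eigen_inner hL uQ V1 LV cd0 hA1.
set J := [set j | _]%SET; set I := [set j | (c + e < _)%R]%SET => Jm Ik.
(* As e < d, every eigenvalue is below c + d or above c + e in absolute value. The counts m and k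
   add up to the dimension, so both are attained and no absolute value lies strictly between c + e
   and c + d. *)
have JI : (~: J)%SET \subset I.
  apply/fintype.subsetP => j; rewrite !inE -leNgt; apply: lt_le_trans.
  by rewrite ltrD2l.
have cJ : (#|J| + #|(~: J)%SET| = k + m)%N by rewrite cardsC card_ord.
have cJI := subset_leq_card JI.
have arith x y z : (x + y = k + m -> x <= m -> y <= z -> z <= k ->
    x = m /\ z <= y)%N by clear; lia.
have [Jm' cIJ] := arith _ _ _ cJ Jm cJI Ik.
have JcI : (~: J)%SET = I by apply/eqP; rewrite eqEcard JI.
have [s [sl sr]] := exists_perm_split Jm'.
exists s; set X := col_perm s V.
have lam_in j : `|lam (s (rshift k j))| <= c + e.
  have : s (rshift k j) \notin (~: J)%SET by rewrite finset.in_setC negbK.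
  by rewrite JcI inE -leNgt.
split=> [i||] //; first by have := sl i; rewrite inE -leNgt.
rewrite /=; set X1 := lsubmx X; set X2 := rsubmx X.
have uX : row_mx X1 X2 \is unitarymx by rewrite hsubmxK col_perm_unitary.
have LX2 : L *m X2 = X2 *m rdiag (fun j => lam (s (rshift k j))).
  have := col_perm_rdiag s LV; rewrite -/X -[X]hsubmxK -/X1 -/X2.
  rewrite (rdiag_block (fun j => lam (s j))) mul_row_block mul_mx_row !mulmx0.
  by rewrite addr0 add0r => /eq_row_mx[].
have [Q11 Q22 Q21 QQ] := row_mx_unitary uQ.
have [X11 X22 _ _] := row_mx_unitary uX.
have adjA (Y : 'M[R[i]]_(k + m, k)) : (Y ^t* *m L *m Y) ^t* = Y ^t* *m L *m Y.
  by rewrite !adjmxM trmxCK hL mulmxA.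
have adjA' (Y : 'M[R[i]]_(k + m, m)) : (Y ^t* *m L *m Y) ^t* = Y ^t* *m L *m Y.
  by rewrite !adjmxM trmxCK hL mulmxA.
(* For Y = Q1 and Y = Q2 these are the two block rows of the eigenvector equation for X2 in the
   basis Q. *)
have comp p (Y : 'M[R[i]]_(k + m, p)) : Y ^t* *m L *m Q1 *m (Q1 ^t* *m X2) +
    Y ^t* *m L *m Q2 *m (Q2 ^t* *m X2) = Y ^t* *m X2 *m rdiag (fun j => lam (s (rshift k j))).
  rewrite -[RHS]mulmxA -LX2 -[X in L *m X]mul1mx -QQ mulmxDl !mulmxDr !mulmxA.
  by [].
have uM : (Q1 ^t* *m X2) ^t* *m (Q1 ^t* *m X2) + (Q2 ^t* *m X2) ^t* *m (Q2 ^t* *m X2) = 1%:M.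
  rewrite !adjmxM !trmxCK -!mulmxA -mulmxDr ![_ *m (_ *m X2)]mulmxA -mulmxDl QQ.
  by rewrite mul1mx X22.
have eB : (Q2 ^t* *m L *m Q1) ^t* = Q1 ^t* *m L *m Q2.
  by rewrite !adjmxM trmxCK hL mulmxA.
have comp1 := comp _ Q1; rewrite -eB in comp1.
have ab := angle_bound m0 c0 d0 r0 e0 ed er (adjA Q1) (adjA' Q2) hA1 hA2 hB uM
  comp1 (comp _ Q2) lam_in.
have rd0 : 0 <= r / d by rewrite divr_ge0 // ltW.
apply: tan_largest_angle_le => //; apply: (angle_bound_compl (sqr_ge0 _) uQ uX) => w.
have d2 : 0 < d ^+ 2 by rewrite exprn_gt0.
by rewrite expr_div_n mulrAC ler_pdivlMr // mulrC !mulmxA; have := ab w.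
Qed.

(* MathComp world. n = k + m with 1 < k and 0 < m, i.e. 1 < k < n. *)
Theorem proposition6 (R : realType) (k m : nat) (hk : (1 < k)%N) (hm : (0 < m)%N)
    (A : 'M[R[i]]_(k + m)) (hA : A \is hermsymmx)
    (Q1 : 'M[R[i]]_(k + m, k)) (Q2 : 'M[R[i]]_(k + m, m))
    (hQ : row_mx Q1 Q2 \is unitarymx)
    (a b d : R) (hab : a <= b) (hd : 0 < d) :
  let outer : set R := [set x | x <= a - d] `|` [set x | b + d <= x] in
  let A1 : 'M[R[i]]_k := Q1 ^t* *m A *m Q1 in
  let A2 : 'M[R[i]]_m := Q2 ^t* *m A *m Q2 in
  let r : R := spectral_norm (A *m Q1 - Q1 *m A1) in
  let delta : R := r * tan (2^-1 * atan (2 * r / d)) in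
  spectrum A1 `<=` real_set outer ->
  spectrum A2 `<=` real_set [set x | a <= x <= b] ->
  r < Num.sqrt 2 * d ->
  [/\ delta < d,
      exists V : 'M[R[i]]_(k + m), orthonormal_eigenvectors A V &
      forall V : 'M[R[i]]_(k + m), orthonormal_eigenvectors A V ->
      exists (s : 'S_(k + m)) (X1 : 'M[R[i]]_(k + m, k))
             (X2 : 'M[R[i]]_(k + m, m))
             (L1 : 'M[R[i]]_k) (L2 : 'M[R[i]]_m),
        let X := row_mx X1 X2 in
        [/\ X = col_perm s V,
            [/\ X ^t* *m A *m X = block_mx L1 0 0 L2,
                is_diag_mx L1 & is_diag_mx L2],
            spectrum L1 `<=` real_set outer,
            spectrum L2 `<=` real_set [set x | a - delta <= x <= b + delta] &
            largest_angle (colspan Q1) (colspan X1) < pi / 2 /\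
            tan (largest_angle (colspan Q1) (colspan X1)) <= r / d]].
Proof.
move=> outer A1 A2 r delta hA1 hA2 hr.
have {}hA : A ^t* = A by apply/hermsymmx_adj.
have r0 : 0 <= r by exact: spectral_norm_ge0.
have [e0 er] : 0 <= delta /\ delta ^+ 2 + d * delta = r ^+ 2.
  exact: half_angle_quadratic.
have ed : delta < d.
  apply: gap_shift_lt er _ => //.
  rewrite -(sqr_sqrtr (ler0n R 2)) -exprMn ltr_pXn2r // nnegrE.
  by rewrite mulr_ge0 ?sqrtr_ge0 // ltW.
split=> //.
  have [P [l [uP eA _]]] := hermitian_rdiag hA.
  exists (P ^t*); split; first by rewrite trmxC_unitary.
  move=> j; exists (l j)%:C; apply/matrixP => i z.
  have AV : A *m P ^t* = P ^t* *m rdiag l by rewrite eA -[LHS]mulmxA (unitarymxP uP) mulmx1.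
  have /matrixP/(_ i j) := AV; rewrite mul_mx_diag !mxE mulrC => <-.
  by apply: eq_bigr => x _; rewrite !mxE.
move=> V hV; have [lam AV] := orthonormal_eigenvectors_rdiag hA hV.
have uV : V \is unitarymx by case: hV.
pose mu : R := (a + b) / 2; pose L := A - mu%:C%:M.
have [Q11 Q22 Q21 QQ] := row_mx_unitary hQ.
have rdiagB n (f : 'I_n -> R) : rdiag f - mu%:C%:M = rdiag (fun i => f i - mu).
  apply/matrixP => i j; rewrite !mxE; case: eqP => // _; rewrite ?mulr1n ?mulr0n ?subr0 //.
  by rewrite rmorphB.
have hL : L ^t* = L.
  have cmu : Num.conj mu%:C = mu%:C :> R[i] := conjc_real mu.
  by rewrite /L linearB /= map_mxB hA tr_scalar_mx map_scalar_mx /= cmu.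
have LV : L *m V = V *m rdiag (fun j => lam j - mu).
  by rewrite -rdiagB mulmxBl mulmxBr AV scalar_mxC.
have conjL p (Y : 'M[R[i]]_(k + m, p)) : Y ^t* *m Y = 1%:M ->
    Y ^t* *m L *m Y = Y ^t* *m A *m Y - mu%:C%:M.
  by move=> uY; rewrite mulmxBr mulmxBl scalar_mxC -[_%:M *m _ *m _]mulmxA uY mulmx1.
have conjP p (P : 'M[R[i]]_p) f : P \is unitarymx ->
    P ^t* *m rdiag f *m P - mu%:C%:M = P ^t* *m rdiag (fun i => f i - mu) *m P.
  move=> uP; rewrite -rdiagB mulmxBr mulmxBl scalar_mxC -[_%:M *m _ *m _]mulmxA.
  by rewrite (unitarymx_adj_mul uP) mulmx1.
have adjA p (Y : 'M[R[i]]_(k + m, p)) : (Y ^t* *m A *m Y) ^t* = Y ^t* *m A *m Y.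
  by rewrite !adjmxM trmxCK hA mulmxA.
have [P1 [al [uP1 eA1 sA1]]] := hermitian_rdiag (adjA _ Q1).
have [P2 [be [uP2 eA2 sA2]]] := hermitian_rdiag (adjA _ Q2).
have eL1 := conjL _ _ Q11; rewrite eA1 (conjP _ _ _ uP1) in eL1.
have eL2 := conjL _ _ Q22; rewrite eA2 (conjP _ _ _ uP2) in eL2.
pose c : R := (b - a) / 2.
have c0 : 0 <= c by rewrite divr_ge0 // subr_ge0.
have hal i : c + d <= `|al i - mu|.
  have [x ox /complexI <-] := hA1 _ (sA1 i); rewrite ler_normr /c /mu.
  by case: ox => /= ox; apply/orP; [right|left]; move: ox; clear; intros; lra.
have hbe i : `|be i - mu| <= c.
  have [x /andP[ax xb] /complexI <-] := hA2 _ (sA2 i); rewrite ler_norml /c /mu.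
  by apply/andP; split; move: ax xb; clear; intros; lra.
(* Since Q2^H Q1 = 0, both the shift and the term Q1 A1 drop out, leaving Q2^H R, and Q2^H does not
   increase lengths. *)
have hB x : nsq (Q2 ^t* *m L *m Q1 *m x) <= r ^+ 2 * nsq x.
  have -> : Q2 ^t* *m L *m Q1 = Q2 ^t* *m (A *m Q1 - Q1 *m A1).
    rewrite !mulmxBr mulmxBl [Q2 ^t* *m (Q1 *m _)]mulmxA Q21 mul0mx subr0.
    by rewrite scalar_mxC -[_%:M *m _ *m _]mulmxA Q21 mulmx0 subr0 mulmxA.
  rewrite -mulmxA; apply: le_trans (nsq_spectral_norm _ _).
  by rewrite -[leRHS](nsq_row_mx_unitary _ hQ) lerDr nsq_ge0.
have [s [sl sr ang]] := spectral_gap_split hm hL hQ uV LV c0 hd r0 e0 ed er uP1 eL1 hal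
  uP2 eL2 hbe hB.
pose X := col_perm s V.
exists s, (lsubmx X), (rsubmx X), (rdiag (fun i => lam (s (lshift m i)))),
  (rdiag (fun j => lam (s (rshift k j)))) => Y.
have YX : Y = X by exact: hsubmxK.
split; [exact: YX | | | | exact: ang].
- split; [| exact: diag_mx_is_diag | exact: diag_mx_is_diag].
  rewrite -(rdiag_block (fun j => lam (s j))) YX -mulmxA (col_perm_rdiag s AV).
  by rewrite mulmxA (unitarymx_adj_mul (col_perm_unitary s uV)) mul1mx.
- move=> z /eigenvalue_rdiag[i ->]; exists (lam (s (lshift m i))) => //.
  have := sl i; rewrite ler_normr /c /mu => /orP[h|h]; [right|left] => /=;
    by move: h; clear; intros; lra.
- move=> z /eigenvalue_rdiag[j ->]; exists (lam (s (rshift k j))) => //=.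
  have := sr j; rewrite ler_norml /c /mu => /andP[h1 h2].
  by apply/andP; split; move: h1 h2; clear; intros; lra.
Qed.
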